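(* Let $A$ be a simple Artinian ring and let $(P,R)$ be an invariant prime of $A$, where $R$ is a Goldie ring. Then there exist a totally ordered semigroup $\Gamma$ and an arithmetical pseudo-valuation $v:\mathcal{F}(R)\to\Gamma$ such that $$P=\{a\in A\mid v(RaR)>0\}\quad\text{and}\quad R=\{a\in A\mid v(RaR)\geq 0\}.$$
   Context: A prime in a ring $A$ is a pair $(P,R)$ where $R$ is a subring of $A$ and $P\subset R$ is a prime ideal of $R$ such that for all $x,y\in A$, $xRy\subseteq P$ implies $x\in P$ or $y\in P$. It is strict fractional if for every $r\neq 0$ in $A$ there are $x,y\in R$ with $0\neq xry\in R$. Put $A^{P}=\{a\in A\mid aP\subseteq P\text{ and }Pa\subseteq P\}$. A ring is Goldie if its set $S$ of regular elements satisfies the Ore condition and the localization $S^{-1}R$ is semisimple Artinian. An invariant prime of a simple Artinian ring $A$ is a strict fractional prime $(P,R)$ of $A$ with $R=A^{P}$, $R$ Goldie (so that $R$ is a prime ring and an order in $A$), and $P$ invariant under all inner automorphisms of $A$ (i.e. $uPu^{-1}\subseteq P$ for all units $u$ of $A$). A fractional $R$-ideal of $A$ is an $R$-bimodule $I\subseteq A$ which contains a regular element of $R$ and satisfies $rI\subseteq R$ for some regular $r\in R$; $\mathcal{F}(R)$ is the set of fractional $R$-ideals, partially ordered by inclusion and a semigroup under multiplication. An arithmetical pseudo-valuation on $R$ is a function $v:\mathcal{F}(R)\to\Gamma$, with $\Gamma$ a partially ordered semigroup (not necessarily commutative, written additively, with neutral element $0$, order compatible with the operation on both sides), such that for all $I,J\in\mathcal{F}(R)$: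 (1) $v(IJ)=v(I)+v(J)$; (2) $v(I+J)\geq\min\{v(I),v(J)\}$; (3) $v(R)=0$; (4) $I\subseteq J$ implies $v(I)\geq v(J)$. For $a\in A$ nonzero, $RaR\in\mathcal{F}(R)$. By convention, $a=0$ is counted as satisfying $v(RaR)>0$. *)

(* Defs.v *)
From HB Require Import structures.
From mathcomp Require Import all_boot all_order all_algebra.
From mathcomp Require Import boolp classical_sets.

Set Implicit Arguments.
Unset Strict Implicit.
Unset Printing Implicit Defensive.

Import Order.TTheory GRing.Theory.

Local Open Scope classical_set_scope.
Local Open Scope ring_scope.

Section RingNotions.
Variable B : nzRingType.

Definition left_ideal (I : set B) : Prop :=
  [/\ I 0, forall x y, I x -> I y -> I (x - y) & forall r x, I x -> I (r * x)].

Definition right_ideal (I : set B) : Prop :=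
  [/\ I 0, forall x y, I x -> I y -> I (x - y) & forall r x, I x -> I (x * r)].

Definition satisfies_dcc (K : set B -> Prop) : Prop :=
  forall I : nat -> set B, (forall n, K (I n)) ->
    (forall n, I n.+1 `<=` I n) ->
    exists n, forall m, (n <= m)%N -> I m = I n.

Definition artinian : Prop :=
  satisfies_dcc left_ideal /\ satisfies_dcc right_ideal.

(* B is an nzRingType, so it is not the zero ring. *)
Definition simple_artinian : Prop :=
  (forall I : set B, left_ideal I -> right_ideal I ->
     I = [set 0] \/ I = setT) /\ artinian.

Definition maximal_left_ideal (M : set B) : Prop :=
  [/\ left_ideal M, M <> setT &
    forall I : set B, left_ideal I -> M `<=` I -> I = M \/ I = setT].

Definition jacobson_radical : set B :=
  [set x | forall M, maximal_left_ideal M -> M x].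

Definition semisimple_artinian : Prop :=
  artinian /\ jacobson_radical = [set 0].

End RingNotions.

Section Goldie.
Variable B : nzRingType.

Definition regular (x : B) : Prop := GRing.lreg x /\ GRing.rreg x.

(* The side is the one for which the fractions are s^-1 r. *)
Definition ore_condition (S : set B) : Prop :=
  forall s r, S s -> exists s' r', S s' /\ s' * r = r' * s.

(* f : B -> Q is (up to isomorphism) the localization B -> S^-1 B. *)
Definition is_localization (S : set B) (Q : nzRingType)
    (f : {rmorphism B -> Q}) : Prop :=
  [/\ forall s, S s -> exists2 w, w * f s = 1 & f s * w = 1,
      forall q, exists s r, S s /\ f s * q = f r &
      forall r, f r = 0 <-> exists2 s, S s & s * r = 0].

Definition goldie : Prop :=
  ore_condition regular /\
  exists (Q : nzRingType) (f : {rmorphism B -> Q}),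
    is_localization regular f /\ semisimple_artinian Q.

End Goldie.

Definition subringOf (A : nzRingType) (R : subringClosed A) : Type :=
  {x : A | x \in R}.
HB.instance Definition _ (A : nzRingType) (R : subringClosed A) :=
  SubChoice.on (subringOf R).
HB.instance Definition _ (A : nzRingType) (R : subringClosed A) :=
  [SubChoice_isSubNzRing of subringOf R by <:].

Section Primes.
Variables (A : nzRingType) (R : subringClosed A).

Definition set_mul (I J : set A) : set A :=
  [set x | exists2 s : seq (A * A), (forall p, p \in s -> I p.1 /\ J p.2)
                                  & x = \sum_(p <- s) p.1 * p.2].

Definition set_add (I J : set A) : set A :=
  [set x | exists i j, [/\ I i, J j & x = i + j]].

Definition principal (a : A) : set A :=
  [set x | exists2 s : seq (A * A),
             (forall p, p \in s -> p.1 \in R /\ p.2 \in R)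
           & x = \sum_(p <- s) p.1 * a * p.2].

Definition bimodule (I : set A) : Prop :=
  [/\ I 0, forall x y, I x -> I y -> I (x - y),
      forall r x, r \in R -> I x -> I (r * x) &
      forall r x, r \in R -> I x -> I (x * r)].

Definition ideal_of (I : set A) : Prop := bimodule I /\ I `<=` [set` R].

Definition prime_ideal_of (P : set A) : Prop :=
  [/\ ideal_of P, P <> [set` R] &
    forall I J, ideal_of I -> ideal_of J -> set_mul I J `<=` P ->
      I `<=` P \/ J `<=` P].

Definition prime_in (P : set A) : Prop :=
  prime_ideal_of P /\
  forall x y : A, (forall r, r \in R -> P (x * r * y)) -> P x \/ P y.

Definition strict_fractional : Prop :=
  forall r : A, r <> 0 ->
    exists x y, [/\ x \in R, y \in R, x * r * y <> 0 & x * r * y \in R].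

Definition idealizer (P : set A) : set A :=
  [set a | (forall p, P p -> P (a * p)) /\ (forall p, P p -> P (p * a))].

Definition inner_invariant (P : set A) : Prop :=
  forall u w : A, u * w = 1 -> w * u = 1 -> forall p, P p -> P (u * p * w).

Definition invariant_prime (P : set A) : Prop :=
  [/\ prime_in P, strict_fractional, [set` R] = idealizer P,
      goldie (subringOf R) & inner_invariant P].

Definition fractional (I : set A) : Prop :=
  [/\ bimodule I,
      exists2 s : subringOf R, regular s & I (val s) &
      exists2 r : subringOf R, regular r & forall x, I x -> val r * x \in R].

Record fracIdeal : Type :=
  FracIdeal { frac_set :> set A; fracP : fractional frac_set }.

Lemma regular1 : regular (1 : subringOf R).
Proof. by split=> x y /=; rewrite ?mul1r ?mulr1. Qed.

Lemma regularM (x y : subringOf R) : regular x -> regular y -> regular (x * y).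
Proof.
move=> [lx rx] [ly ry]; split=> u v /=; first by rewrite -!mulrA => /lx /ly.
by rewrite !mulrA => /ry /rx.
Qed.

Lemma bimoduleD I x y : bimodule I -> I x -> I y -> I (x + y).
Proof.
move=> [I0 IB _ _] Ix Iy; rewrite -[y]opprK; apply: (IB) => //.
by rewrite -sub0r; apply: IB.
Qed.

Lemma fractional_ring : fractional [set` R].
Proof.
split; last 2 first.
- by exists 1; [exact: regular1 | rewrite /= rpred1].
- by exists 1; [exact: regular1 | move=> x /= xR; rewrite mul1r].
split=> /=; [exact: rpred0 | exact: rpredB | |].
- by move=> r x; exact: rpredM.
- by move=> r x rR xR; exact: rpredM.
Qed.

Lemma fractional_mul (I J : fracIdeal) : fractional (set_mul I J).
Proof.
case: I J => I [Ib [s sreg Is] [r rreg rI]] [J [Jb [t treg Jt] [q qreg qJ]]] /=.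
have [I0 IB Il Ir] := Ib; have [J0 JB Jl Jr] := Jb.
split; last 2 first.
- exists (s * t); first exact: regularM.
  exists [:: (val s, val t)]; last by rewrite big_seq1.
  by move=> p; rewrite inE => /eqP ->.
- exists (q * r); first exact: regularM.
  move=> _ [l lP ->]; rewrite mulr_sumr big_seq; apply: rpred_sum => p /lP[Ip Jp].
  by rewrite /= -mulrA [val r * _]mulrA; apply: qJ; apply: Jl => //; apply: rI.
split.
- by exists [::] => //; rewrite big_nil.
- move=> _ _ [l lP ->] [k kP ->].
  exists (l ++ [seq (- p.1, p.2) | p <- k]).
    move=> p; rewrite mem_cat => /orP[/lP//|/mapP[p' /kP[Ip Jp] ->]] /=.
    by split=> //; rewrite -sub0r; apply: IB.
  rewrite big_cat big_map -sumrN; congr (_ + _).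
  by apply: eq_bigr => p _; rewrite mulNr.
- move=> a _ aR [l lP ->]; exists [seq (a * p.1, p.2) | p <- l].
    by move=> _ /mapP[p /lP[Ip Jp] ->]; split=> //; apply: Il.
  by rewrite big_map mulr_sumr; apply: eq_bigr => p _; rewrite mulrA.
- move=> a _ aR [l lP ->]; exists [seq (p.1, p.2 * a) | p <- l].
    by move=> _ /mapP[p /lP[Ip Jp] ->]; split=> //; apply: Jr.
  by rewrite big_map mulr_suml; apply: eq_bigr => p _; rewrite mulrA.
Qed.

Lemma fractional_add (goldieR : goldie (subringOf R)) (I J : fracIdeal) :
  fractional (set_add I J).
Proof.
case: goldieR => ore _.
case: I J => I [Ib [s sreg Is] [r rreg rI]] [J [Jb [t treg Jt] [q qreg qJ]]] /=.
have [I0 IB Il Ir] := Ib; have [J0 JB Jl Jr] := Jb.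
split; last 2 first.
- by exists s => //; exists (val s), 0; rewrite addr0.
- have [s' [r' [s'reg e]]] := ore q r qreg.
  exists (s' * r); first exact: regularM.
  move=> _ [i [j [Ii Jj ->]]]; rewrite mulrDr rpredD //.
    by rewrite /= -mulrA rpredM ?rI //; exact: valP.
  by rewrite e /= -mulrA rpredM ?qJ //; exact: valP.
split.
- by exists 0, 0; rewrite addr0.
- move=> _ _ [i [j [Ii Jj ->]]] [i' [j' [Ii' Jj' ->]]].
  by exists (i - i'), (j - j'); split; [exact: IB | exact: JB | rewrite opprD addrACA].
- move=> a _ aR [i [j [Ii Jj ->]]]; exists (a * i), (a * j).
  by split; [exact: Il | exact: Jl | rewrite mulrDr].
- move=> a _ aR [i [j [Ii Jj ->]]]; exists (i * a), (j * a).
  by split; [exact: Ir | exact: Jr | rewrite mulrDl].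
Qed.

Definition frac_one : fracIdeal := FracIdeal fractional_ring.
Definition frac_mul (I J : fracIdeal) : fracIdeal :=
  FracIdeal (fractional_mul I J).
Definition frac_add (goldieR : goldie (subringOf R)) (I J : fracIdeal) :
  fracIdeal := FracIdeal (fractional_add goldieR I J).

End Primes.

Definition ordered_semigroup (d : Order.disp_t) (Gamma : porderType d)
    (add : Gamma -> Gamma -> Gamma) (zero : Gamma) : Prop :=
  [/\ associative add, left_id zero add, right_id zero add,
      forall x y z, (x <= y)%O -> (add z x <= add z y)%O &
      forall x y z, (x <= y)%O -> (add x z <= add y z)%O].

(* In the second clause the minimum of two values exists only if they are
   comparable; in a totally ordered Gamma they always are. *)
Definition arithmetical_pseudo_valuation (A : nzRingType) (R : subringClosed A)
    (goldieR : goldie (subringOf R)) (d : Order.disp_t) (Gamma : porderType d)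
    (add : Gamma -> Gamma -> Gamma) (zero : Gamma)
    (v : fracIdeal R -> Gamma) : Prop :=
  [/\ forall I J, v (frac_mul I J) = add (v I) (v J),
      forall I J, (v I >=< v J)%O ->
        (Order.min (v I) (v J) <= v (frac_add goldieR I J))%O,
      v (frac_one R) = zero &
      forall I J : fracIdeal R, I `<=` J -> (v J <= v I)%O].

(* The set of all a such that v (R a R) satisfies C, where a = 0, for which
   R a R is not a fractional ideal, is put in the set by convention. *)
Definition value_set (A : nzRingType) (R : subringClosed A) (T : Type)
    (v : fracIdeal R -> T) (C : T -> Prop) : set A :=
  [set a | a = 0 \/ exists2 I : fracIdeal R, I = principal R a :> set A & C (v I)].

(* Main.v *)
(* If A has an idempotent e different from 0 and 1, then R = A: for n ^ 2 = 0
   the prime property and the invariance of P put 1 + n in R or its inverse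
   1 - n in P, so R contains e A (1 - e) and (1 - e) A e, and these generate A
   because A is simple.  Otherwise A is a division ring and, for x <> 0, x is in
   R or its inverse is in P; thus R is an invariant valuation ring with maximal
   ideal P.  In both cases the fractional R-ideals form a chain, and the
   valuation is the identity of F(R), ordered by reverse inclusion. *)
Require Import Defs.
From HB Require Import structures.
From mathcomp Require Import all_boot all_order all_algebra.
From mathcomp Require Import boolp classical_sets.

Set Implicit Arguments.
Unset Strict Implicit.
Unset Printing Implicit Defensive.

Import Order.TTheory GRing.Theory.

Local Open Scope classical_set_scope.
Local Open Scope ring_scope.

(** * Minimal left ideals and idempotents of a simple Artinian ring *)

Lemma minimal_left_ideal (B : nzRingType) :
  satisfies_dcc (@left_ideal B) ->
  exists L : set B, [/\ left_ideal L, L <> [set 0] &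
    forall I, left_ideal I -> I `<=` L -> I = [set 0] \/ I = L].
Proof.
move=> dcc; apply: contrapT => noL.
pose nz (L : set B) := left_ideal L /\ L <> [set 0].
(* The hypothesis on [L] sits under the existential, so that [choice] yields a function on all sets;
   iterating it from the whole ring gives a strictly descending chain. *)
have step (L : set B) : exists I : set B, nz L -> [/\ nz I, I `<=` L & I <> L].
  apply: contrapT => noI; apply: noL; exists L.
  have nzL : nz L by apply: contrapT => nnz; apply: noI; exists L.
  have [Ll L0] := nzL; split=> // I Il IL.
  apply: contrapT => /not_orP[I0 IneL]; apply: noI; exists I => _; split=> //.
have [f fP] := choice step.
pose I n := iter n f setT.
have nzI n : nz (I n).
  elim: n => [|n IH]; last by have [] := fP _ IH.
  split=> //= /seteqP[/(_ 1 Logic.I) /= e _].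
  by have := oner_neq0 B; rewrite e eqxx.
have [n /(_ n.+1 (leqnSn n)) En] :=
  dcc I (fun n => (nzI n).1) (fun n => let: And3 _ s _ := fP _ (nzI n) in s).
by have [_ _] := fP _ (nzI n); apply.
Qed.

Lemma two_sided_ideal_full (B : nzRingType) (I : set B) (x : B) :
  simple_artinian B -> left_ideal I -> right_ideal I -> I x -> x <> 0 ->
  I = setT.
Proof.
by move=> [simpleB _] Il Ir Ix x0; case: (simpleB I Il Ir) => // I0; move: Ix; rewrite I0.
Qed.

(** Brauer's lemma: a minimal left ideal [L] with nonzero square contains a nonzero idempotent [e].
    If [e] is 1, then [L] is the whole ring, and minimality makes [B] a division ring. *)
Lemma division_or_idempotent (B : nzRingType) :
  simple_artinian B ->
  (forall x : B, x <> 0 -> exists y, x * y = 1 /\ y * x = 1) \/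
  (exists e : B, [/\ e * e = e, e <> 0 & e <> 1]).
Proof.
move=> sB; have [L [Ll L0 Lmin]] := minimal_left_ideal sB.2.1.
have [L00 LB LM] := Ll.
have [l Ll0 l0] : exists2 l, L l & l <> 0.
  apply: contrapT => no; apply: L0; apply/seteqP; split=> [x Lx|x ->] //=.
  by apply: contrapT => x0; apply: no; exists x.
(* If [L] had square zero, its left annihilator [J] would be a two-sided ideal containing [l], hence
   the whole ring, and 1 would annihilate [L]. *)
have [x Lx [y Ly yx0]] : exists2 x, L x & exists2 y, L y & y * x <> 0.
  apply: contrapT => no.
  pose J : set B := [set a | forall x, L x -> a * x = 0].
  have JT : J = setT.
    apply: (two_sided_ideal_full (x := l)) => //.
    - split=> [z _|a b Ja Jb z Lz|r a Ja z Lz]; first by rewrite mul0r.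
        by rewrite mulrBl Ja // Jb // subr0.
      by rewrite -mulrA Ja // mulr0.
    - split=> [z _|a b Ja Jb z Lz|r a Ja z Lz]; first by rewrite mul0r.
        by rewrite mulrBl Ja // Jb // subr0.
      by rewrite -mulrA Ja //; apply: LM.
    - move=> z Lz; apply: contrapT => lz0; apply: no; exists z => //; by exists l.
  have : J 1 by rewrite JT.
  by move=> /(_ l Ll0); rewrite mul1r.
have x0 : x <> 0 by move=> x0; apply: yx0; rewrite x0 mulr0.
(* The left ideal [L x] lies in [L] and contains [y * x], which is nonzero; by minimality it is [L],
   so it contains [x]. *)
have [e Le ex] : exists2 e, L e & e * x = x.
  pose I := [set z * x | z in L].
  have Il : left_ideal I.
    split; first by exists 0; rewrite ?mul0r.
      by move=> _ _ [a La <-] [b Lb <-]; exists (a - b); [apply: LB|rewrite mulrBl].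
    by move=> r _ [a La <-]; exists (r * a); [apply: LM|rewrite mulrA].
  have IL : I `<=` L by move=> _ [a La <-]; apply: LM.
  have [I0|IeL] := Lmin I Il IL; last first.
    by have [e Le ex] : I x; [rewrite IeL | exists e].
  by case: yx0; have : I (y * x) by [exists y]; rewrite I0.
have e0 : e <> 0 by move=> e0; apply: x0; rewrite -ex e0 mul0r.
(* The annihilator of [x] in [L] misses [y], so it is zero by minimality; it contains
   [e * e - e]. *)
have ee : e * e = e.
  pose N : set B := [set z | L z /\ z * x = 0].
  have Nl : left_ideal N.
    split; first by split; rewrite ?mul0r.
      by move=> a b [La ax] [Lb bx]; split; [apply: LB|rewrite mulrBl ax bx subr0].
    by move=> r a [La ax]; split; [apply: LM|rewrite -mulrA ax mulr0].
  have [N0|NL] := Lmin N Nl (fun z Nz => Nz.1); last first.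
    by have [_ /yx0] : N y by rewrite NL.
  have : N (e * e - e).
    by split; [apply: LB => //; apply: LM|rewrite mulrBl -mulrA !ex subrr].
  by rewrite N0 => /= /eqP; rewrite subr_eq0 => /eqP.
have [e1|ne1] := pselect (e = 1); last by right; exists e.
(* Now [L] is the whole ring, so for nonzero [z] the left ideal [B z] equals [L] and contains 1. *)
left; have L1 : L 1 by rewrite -e1.
have linv (z : B) : z <> 0 -> exists w, w * z = 1.
  move=> z0; pose I := [set w * z | w in @setT B].
  have Il : left_ideal I.
    split; first by exists 0; rewrite ?mul0r.
      by move=> _ _ [a _ <-] [b _ <-]; exists (a - b); rewrite ?mulrBl.
    by move=> r _ [a _ <-]; exists (r * a); rewrite ?mulrA.
  have IL : I `<=` L by move=> t _; rewrite -[t]mulr1; apply: LM.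
  have [I0|IeL] := Lmin I Il IL; last first.
    by have [w _ wz] : I 1; [rewrite IeL | exists w].
  by case: z0; have : I z by [exists 1; rewrite ?mul1r]; rewrite I0.
move=> z /linv[w wz]; exists w; split=> //.
have [|t tw] := linv w.
  by move=> w0; have := oner_neq0 B; rewrite -wz w0 mul0r eqxx.
by have -> : z = t by rewrite -[z]mul1r -tw -mulrA wz mulr1.
Qed.

(** * Subrings that contain every element of square zero *)

(** With [f = 1 - e], each [e c f d e] is the product of [e c f] and [f d e], both of square zero.
    So the two-sided ideal [J] contains [f], which is nonzero, and by simplicity it contains 1. *)
Lemma corner_sub (A : nzRingType) (R : subringClosed A) (e : A) :
  simple_artinian A -> (forall n : A, n * n = 0 -> n \in R) ->
  e * e = e -> e <> 1 -> forall a, e * a * e \in R.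
Proof.
move=> sA nilR ee e1 a.
have e1e : e * (1 - e) = 0 by rewrite mulrBr mulr1 ee subrr.
have ee1 : (1 - e) * e = 0 by rewrite mulrBl mul1r ee subrr.
pose J : set A := [set x | forall a b, e * a * x * b * e \in R].
have JT : J = setT.
  apply: (two_sided_ideal_full (x := 1 - e)) => //.
  - split=> [c d|x y Jx Jy c d|r x Jx c d].
    + by rewrite mulr0 !mul0r rpred0.
    + by rewrite mulrBr !mulrBl rpredB.
    + by have := Jx (c * r) d; rewrite !mulrA.
  - split=> [c d|x y Jx Jy c d|r x Jx c d].
    + by rewrite mulr0 !mul0r rpred0.
    + by rewrite mulrBr !mulrBl rpredB.
    + by have := Jx c (r * d); rewrite !mulrA.
  - move=> c d; have ff : (1 - e) * (1 - e) = 1 - e.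
      by rewrite mulrBr mulr1 ee1 subr0.
    have -> : e * c * (1 - e) * d * e = (e * c * (1 - e)) * ((1 - e) * d * e).
      by rewrite -{1}ff !mulrA.
    apply: rpredM; apply: nilR.
      by rewrite -!mulrA [(1 - e) * (e * _)]mulrA ee1 mul0r !mulr0.
    by rewrite -!mulrA [e * ((1 - e) * _)]mulrA e1e mul0r !mulr0.
  - by move/eqP; rewrite subr_eq0 => /eqP /esym.
have : J 1 by rewrite JT.
by move=> /(_ a 1); rewrite !mulr1.
Qed.

(** Peirce decomposition: the two off-diagonal components of [a] have square zero, and [corner_sub]
    handles the diagonal ones, for [e] and for [1 - e]. *)
Lemma idempotent_full (A : nzRingType) (R : subringClosed A) (e : A) :
  simple_artinian A -> (forall n : A, n * n = 0 -> n \in R) ->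
  e * e = e -> e <> 0 -> e <> 1 -> forall a, a \in R.
Proof.
move=> sA nilR ee e0 e1 a.
have e1e : e * (1 - e) = 0 by rewrite mulrBr mulr1 ee subrr.
have ee1 : (1 - e) * e = 0 by rewrite mulrBl mul1r ee subrr.
have -> : a = (e * a * e + e * a * (1 - e))
            + ((1 - e) * a * e + (1 - e) * a * (1 - e)).
  by rewrite -!mulrDr [e + _]addrC subrK !mulr1 -mulrDl [e + _]addrC subrK mul1r.
rewrite rpredD // rpredD //.
- exact: corner_sub.
- by apply: nilR; rewrite -!mulrA [(1 - e) * (e * _)]mulrA ee1 mul0r !mulr0.
- by apply: nilR; rewrite -!mulrA [e * ((1 - e) * _)]mulrA e1e mul0r !mulr0.
- apply: corner_sub => //; first by rewrite mulrBr mulr1 ee1 subr0.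
  by move=> /eqP; rewrite -subr_eq0 addrAC subrr sub0r oppr_eq0 => /eqP.
Qed.

(** * The product of subsets of a ring *)

Section SetMul.
Variable A : nzRingType.
Implicit Types I J K : set A.

Lemma set_mul0 I J : set_mul I J 0.
Proof. by exists [::]; rewrite ?big_nil. Qed.

Lemma set_mulD I J x y :
  set_mul I J x -> set_mul I J y -> set_mul I J (x + y).
Proof.
move=> [s sP ->] [t tP ->]; exists (s ++ t); last by rewrite big_cat.
by move=> p; rewrite mem_cat => /orP[/sP|/tP].
Qed.

Lemma mem_set_mul I J x y : I x -> J y -> set_mul I J (x * y).
Proof.
move=> Ix Jy; exists [:: (x, y)]; last by rewrite big_seq1.
by move=> p; rewrite inE => /eqP->.
Qed.

Lemma set_mul_sub I J K :
  K 0 -> (forall x y, K x -> K y -> K (x + y)) ->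
  (forall x y, I x -> J y -> K (x * y)) -> set_mul I J `<=` K.
Proof.
move=> K0 KD KM _ [s sP ->]; rewrite big_seq.
by apply: big_ind => // p /sP[]; apply: KM.
Qed.

Lemma set_mulA I J K : set_mul I (set_mul J K) = set_mul (set_mul I J) K.
Proof.
apply/seteqP; split; (apply: set_mul_sub; first exact: set_mul0);
  do ?exact: set_mulD.
(* For fixed [x], the [y] with [x * y] in the target contain 0 and are closed under sums, so
   [set_mul_sub] applies a second time, to the inner product. *)
- move=> x y Ix; move: y.
  apply: (set_mul_sub (K := [set y | set_mul (set_mul I J) K (x * y)])).
  + by rewrite /= mulr0; apply: set_mul0.
  + by move=> y z /=; rewrite mulrDr; apply: set_mulD.
  + by move=> y z Jy Kz; rewrite /= mulrA; do 2 ?apply: mem_set_mul.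
- move=> x y XY Ky; move: x XY.
  apply: (set_mul_sub (K := [set x | set_mul I (set_mul J K) (x * y)])).
  + by rewrite /= mul0r; apply: set_mul0.
  + by move=> x z /=; rewrite mulrDl; apply: set_mulD.
  + by move=> x z Ix Jz; rewrite /= -mulrA; do 2 ?apply: mem_set_mul.
Qed.

Lemma set_mulS I I' J J' :
  I `<=` I' -> J `<=` J' -> set_mul I J `<=` set_mul I' J'.
Proof.
move=> II' JJ'; apply: set_mul_sub; [exact: set_mul0 | exact: set_mulD |].
by move=> x y /II' Ix /JJ' Jy; apply: mem_set_mul.
Qed.

End SetMul.

(** * Bimodules over [R] and the ideals [R a R] *)

Section Bimodules.
Variables (A : nzRingType) (R : subringClosed A).

Lemma set_mul1l (I : set A) : bimodule R I -> set_mul [set` R] I = I.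
Proof.
move=> Ib; have [I0 _ Il _] := Ib; apply/seteqP; split.
  by apply: set_mul_sub => // x y; apply: bimoduleD Ib.
by move=> x Ix; rewrite -[x]mul1r; apply: mem_set_mul; rewrite //= rpred1.
Qed.

Lemma set_mul1r (I : set A) : bimodule R I -> set_mul I [set` R] = I.
Proof.
move=> Ib; have [I0 _ _ Ir] := Ib; apply/seteqP; split.
  by apply: set_mul_sub => // x y; [apply: bimoduleD Ib | move=> Ix yR; apply: Ir].
by move=> x Ix; rewrite -[x]mulr1; apply: mem_set_mul; rewrite //= rpred1.
Qed.

Lemma bimodule_principal (a : A) : bimodule R (principal R a).
Proof.
split.
- by exists [::]; rewrite ?big_nil.
- move=> _ _ [s sP ->] [t tP ->].
  exists (s ++ [seq (- p.1, p.2) | p <- t]).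
    move=> p; rewrite mem_cat => /orP[/sP//|/mapP[q /tP[q1 q2] ->]] /=.
    by rewrite rpredN.
  rewrite big_cat big_map -sumrN; congr (_ + _).
  by apply: eq_bigr => p _; rewrite !mulNr.
- move=> r _ rR [s sP ->]; exists [seq (r * p.1, p.2) | p <- s].
    by move=> _ /mapP[q /sP[q1 q2] ->]; rewrite rpredM.
  by rewrite big_map mulr_sumr; apply: eq_bigr => p _; rewrite !mulrA.
- move=> r _ rR [s sP ->]; exists [seq (p.1, p.2 * r) | p <- s].
    by move=> _ /mapP[q /sP[q1 q2] ->]; rewrite rpredM.
  by rewrite big_map mulr_suml; apply: eq_bigr => p _; rewrite !mulrA.
Qed.

Lemma mem_principal (a : A) : principal R a a.
Proof.
exists [:: (1, 1)]; last by rewrite big_seq1 mulr1 mul1r.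
by move=> p; rewrite inE => /eqP->; rewrite rpred1.
Qed.

Lemma principal_sub (a : A) (I : set A) :
  bimodule R I -> I a -> principal R a `<=` I.
Proof.
move=> Ib Ia _ [s sP ->]; have [I0 _ Il Ir] := Ib; rewrite big_seq.
apply: big_ind => // [x y|p /sP[p1 p2]]; first exact: bimoduleD Ib.
by apply: Ir => //; apply: Il.
Qed.

Lemma fracIdeal_eq (I J : fracIdeal R) : I = J :> set A -> I = J.
Proof.
case: I J => I IP [J JP] /= E; move: JP; rewrite -E => JP.
by congr FracIdeal; apply: Prop_irrelevance.
Qed.

Lemma frac_bimodule (I : fracIdeal R) : bimodule R I.
Proof. by case: (fracP I). Qed.

(** * The valuation attached to a chain of fractional ideals *)

Definition frac_chain : Prop :=
  forall I J : fracIdeal R, I `<=` J \/ J `<=` I.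

(* The hypothesis is a phantom argument: it indexes the total order below. *)
Definition frac_dual (_ : frac_chain) : Type := fracIdeal R.

Variable chain : frac_chain.

HB.instance Definition _ := gen_eqMixin (frac_dual chain).
HB.instance Definition _ := gen_choiceMixin (frac_dual chain).

Definition frac_dual_le (I J : frac_dual chain) : bool :=
  `[< frac_set J `<=` frac_set I >].

Lemma frac_dual_le_refl : reflexive frac_dual_le.
Proof. by move=> I; apply/asboolP. Qed.

Lemma frac_dual_le_anti : antisymmetric frac_dual_le.
Proof.
move=> I J /andP[/asboolP JI /asboolP IJ].
by apply: fracIdeal_eq; apply/seteqP.
Qed.

Lemma frac_dual_le_trans : transitive frac_dual_le.
Proof.
move=> J I K /asboolP JI /asboolP KJ; apply/asboolP.
exact: subset_trans KJ JI.
Qed.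

HB.instance Definition _ := Order.Le_isPOrder.Build (Order.Disp tt tt)
  (frac_dual chain) frac_dual_le_refl frac_dual_le_anti frac_dual_le_trans.

Lemma frac_dual_le_total : total frac_dual_le.
Proof.
by move=> I J; case: (chain I J) => IJ; apply/orP; [right|left]; apply/asboolP.
Qed.

HB.instance Definition _ :=
  Order.POrder_isTotal.Build _ (frac_dual chain) frac_dual_le_total.

Lemma frac_dual_leP (I J : frac_dual chain) :
  (I <= J)%O <-> frac_set J `<=` frac_set I.
Proof. by split=> [/asboolP|?] //; apply/asboolP. Qed.

Lemma ordered_semigroup_frac_dual :
  ordered_semigroup (Gamma := frac_dual chain) (@frac_mul A R) (frac_one R).
Proof.
split.
- by move=> I J K; apply: fracIdeal_eq; apply: set_mulA.
- by move=> I; apply: fracIdeal_eq; apply: set_mul1l; apply: frac_bimodule.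
- by move=> I; apply: fracIdeal_eq; apply: set_mul1r; apply: frac_bimodule.
- by move=> I J K /frac_dual_leP IJ; apply/frac_dual_leP; apply: set_mulS.
- by move=> I J K /frac_dual_leP IJ; apply/frac_dual_leP; apply: set_mulS.
Qed.

(** The chain condition serves the inequality for sums: the minimum in the reversed order is the
    larger of the two ideals, and it contains their sum. *)
Lemma apv_frac_dual (goldieR : goldie (subringOf R)) :
  arithmetical_pseudo_valuation goldieR (Gamma := frac_dual chain)
    (@frac_mul A R) (frac_one R) id.
Proof.
split=> // [I J _|I J IJ]; last exact/frac_dual_leP.
have [_ /= IB _ _] := frac_bimodule I.
rewrite ge_min; apply/orP.
case: (chain I J) => [IJ|JI]; [right|left]; apply/frac_dual_leP => _ [i [j [Ii Jj ->]]];
  apply: bimoduleD; do ?exact: frac_bimodule; by [apply: IJ | apply: JI |].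
Qed.

(** The common end of both cases. A value at least 0 means that [R a R] lies in [R], that is, [a] is
    in [R]. A positive value means that [R a R] is moreover proper: it is so for [a] in [P], being
    inside [P], and not for [a] in [R] outside [P]. *)
Lemma frac_valuation (goldieR : goldie (subringOf R)) (P : set A) :
  bimodule R P -> P `<=` [set` R] -> P <> [set` R] ->
  (forall a, a <> 0 -> fractional R (principal R a)) ->
  (forall a, a \in R -> ~ P a -> principal R a = [set` R]) ->
  exists (d : Order.disp_t) (Gamma : orderType d)
    (add : Gamma -> Gamma -> Gamma) (zero : Gamma) (v : fracIdeal R -> Gamma),
    [/\ ordered_semigroup add zero,
        arithmetical_pseudo_valuation goldieR add zero v,
        P = value_set v (fun g => (zero < g)%O) &
        [set` R] = value_set v (fun g => (zero <= g)%O)].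
Proof.
move=> Pb PR PneR fracpr prR.
have [P0 _ Pl _] := Pb.
have [Rb _ _] := fractional_ring R.
exists (Order.Disp tt tt), (frac_dual chain).
exists (@frac_mul A R), (frac_one R), id.
split; [exact: ordered_semigroup_frac_dual | exact: apv_frac_dual | |].
- apply/seteqP; split=> [a Pa|a [->//|[I IE]]].
    have [->|a0] := pselect (a = 0); [by left | right].
    exists (FracIdeal (fracpr a a0)) => //.
    have prP : principal R a `<=` P by apply: principal_sub.
    rewrite lt_neqAle; apply/andP; split; last first.
      by apply/frac_dual_leP => /= x /prP /PR.
    apply/eqP => /(congr1 (@frac_set A R)) /= E; apply: PneR.
    by apply/seteqP; split=> //; rewrite E.
  rewrite lt_neqAle => /andP[/eqP ne /frac_dual_leP /= IR].
  have aR : a \in R by apply: IR; rewrite IE; apply: mem_principal.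
  apply: contrapT => nPa; apply: ne; apply: fracIdeal_eq.
  by rewrite IE prR.
- apply/seteqP; split=> [a aR|a [->|[I IE /frac_dual_leP /= IR]]].
  + have [->|a0] := pselect (a = 0); [by left | right].
    exists (FracIdeal (fracpr a a0)) => //.
    by apply/frac_dual_leP; apply: principal_sub.
  + exact: rpred0.
  + by apply: IR; rewrite IE; apply: mem_principal.
Qed.

End Bimodules.

(** * Units of [A] and an invariant prime *)

Section Dichotomy.
Variables (A : nzRingType) (R : subringClosed A) (P : set A).
Hypothesis primePR : invariant_prime R P.

(** [R] inherits the invariance of [P], being its idealizer: multiplication by [u * r * w] is
    conjugation by [w], then multiplication by [r], then conjugation by [u], and each step preserves
    [P]. *)
Lemma invariant_conj u w r :
  u * w = 1 -> w * u = 1 -> r \in R -> u * r * w \in R.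
Proof.
case: primePR => _ _ RE _ inv uw wu rR.
have : [set` R] r by [].
rewrite RE => -[rP Pr].
suff : [set` R] (u * r * w) by [].
rewrite RE; split=> p Pp.
  have -> : u * r * w * p = u * (r * (w * p * u)) * w.
    by rewrite !mulrA -[RHS]mulrA uw mulr1.
  by apply: (inv _ _ uw wu); apply: rP; apply: (inv _ _ wu uw).
have -> : p * (u * r * w) = u * ((w * p * u) * r) * w.
  by rewrite !mulrA uw mul1r.
by apply: (inv _ _ uw wu); apply: Pr; apply: (inv _ _ wu uw).
Qed.

(* If, say, u p is not in P for some p in P, then w (u p) = p, the prime
   property and w R = R w give w in P. *)
Lemma unit_in_ring_or_inv_in_prime u w :
  u * w = 1 -> w * u = 1 -> u \in R \/ P w.
Proof.
move=> uw wu; have [[[[[P0 PB Pl Pr] PR] _ _] pr] _ RE _ _] := primePR.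
have [uR|nuR] := pselect ([set` R] u); first by left.
right; apply: contrapT => nPw; apply: nuR; rewrite RE.
split=> p Pp.
  have [|//|//] := pr w (u * p) _ => r rR.
  by rewrite mulrA; apply: Pl => //; apply: invariant_conj.
have [|//|//] := pr (p * u) w _ => r rR.
by rewrite -!mulrA; apply: Pr => //; rewrite mulrA; apply: invariant_conj.
Qed.

Lemma square_zero_in_ring n : n * n = 0 -> n \in R.
Proof.
move=> nn.
have e1 : (1 + n) * (1 - n) = 1.
  by rewrite mulrDl mul1r mulrBr mulr1 nn subr0 subrK.
have e2 : (1 - n) * (1 + n) = 1.
  by rewrite mulrBl mul1r mulrDr mulr1 nn addr0 addrK.
have [[[[_ PR] _ _] _] _ _ _ _] := primePR.
case: (unit_in_ring_or_inv_in_prime e1 e2) => [h|/PR h].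
  by rewrite -[n](addKr 1) rpredD // rpredN rpred1.
by rewrite -[n](subKr 1) rpredB // rpred1.
Qed.

End Dichotomy.

(** * The case where [R] is all of [A] *)

Section FullRing.
Variables (A : nzRingType) (R : subringClosed A).
Hypotheses (simpleA : simple_artinian A) (fullR : forall a, a \in R).

Lemma full_bimodule (I : set A) (x : A) :
  bimodule R I -> I x -> x <> 0 -> I = [set` R].
Proof.
move=> [I0 IB Il Ir] Ix x0.
have -> : [set` R] = setT by apply/seteqP; split=> // y _; apply: fullR.
apply: (two_sided_ideal_full simpleA _ _ Ix x0); split=> // r y.
  exact: Il.
exact: Ir.
Qed.

Lemma full_frac (I : fracIdeal R) : frac_set I = [set` R].
Proof.
have [Ib [s [ls _] Is] _] := fracP I.
(* A regular [s] is nonzero, since cancelling it in [s * 1 = s * 0] would give 1 = 0. *)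
apply: full_bimodule Ib Is _ => s0.
have : s * 1 = s * 0 by apply: val_inj; rewrite /= s0 !mul0r.
by move/ls/eqP; rewrite (negbTE (oner_neq0 _)).
Qed.

Lemma full_principal a : a <> 0 -> principal R a = [set` R].
Proof.
move=> a0; apply: full_bimodule a0; first exact: bimodule_principal.
exact: mem_principal.
Qed.

End FullRing.

(** * The case of a division ring [A] *)

Section DivisionRing.
Variables (A : nzRingType) (R : subringClosed A) (P : set A).
Hypotheses (primePR : invariant_prime R P)
  (divA : forall x : A, x <> 0 -> exists y, x * y = 1 /\ y * x = 1).

Lemma division_regular (x : subringOf R) : val x <> 0 -> regular x.
Proof.
move=> /divA[w [xw wx]]; split=> y z /(congr1 val) /= E; apply: val_inj => /=.
  by rewrite -[val y]mul1r -wx -mulrA E mulrA wx mul1r.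
by rewrite -[val y]mulr1 -xw mulrA E -mulrA xw mulr1.
Qed.

(** Since [a] is not in [P], the dichotomy applied to its inverse [w] puts [w] in [R]; thus [a] is a
    unit of [R]. *)
Lemma division_principal_full a :
  a \in R -> ~ P a -> principal R a = [set` R].
Proof.
move=> aR nPa; have [[[[[P0 _ _ _] _] _ _] _] _ _ _ _] := primePR.
have [Rb _ _] := fractional_ring R.
have [|w [aw wa]] := @divA a; first by move=> a0; apply: nPa; rewrite a0.
have wR : w \in R by case: (unit_in_ring_or_inv_in_prime primePR wa aw).
apply/seteqP; split; first exact: principal_sub.
move=> r rR; have [_ _ pl _] := bimodule_principal R a.
by rewrite -[r]mulr1 -wa mulrA; apply: pl (mem_principal R a); apply: rpredM.
Qed.

(** If [a] is in [R], then [a] is the regular element and 1 the denominator. Otherwise the inverse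
    [w] is in [P], hence in [R]: it is a denominator, and [w * a = 1] is the regular element. *)
Lemma division_frac_principal a : a <> 0 -> fractional R (principal R a).
Proof.
move=> a0; have [[[[[P0 _ _ _] PR] _ _] _] _ _ _ _] := primePR.
have [Rb _ _] := fractional_ring R.
have prb := bimodule_principal R a; have [_ _ pl _] := prb.
have [w [aw wa]] := divA a0.
case: (unit_in_ring_or_inv_in_prime primePR aw wa) => [aR|/PR wR].
  split=> //.
    by exists (Sub a aR); [apply: division_regular | apply: mem_principal].
  exists 1 => [|x /(principal_sub Rb aR)]; first exact: regular1.
  by rewrite mul1r.
split=> //.
  exists 1; first exact: regular1.
  by rewrite /= -wa; apply: pl => //; apply: mem_principal.
exists (Sub w wR).
  apply: division_regular => /= w0.
  by have := oner_neq0 A; rewrite -wa w0 mul0r eqxx.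
(* It suffices that the [x] with [w * x] in [R] form a bimodule containing [a]; closure under left
   multiplication by [r] holds because the conjugate [w * r * a] is in [R]. *)
move=> x; apply: (principal_sub (I := [set x | w * x \in R])) => /=; last first.
  by rewrite wa rpred1.
split=> [|y z yR zR|r y rR yR|r y rR yR] /=.
- by rewrite mulr0 rpred0.
- by rewrite mulrBr rpredB.
- have -> : w * (r * y) = w * r * a * (w * y).
    by rewrite -!mulrA [a * _]mulrA aw mul1r.
  by apply: rpredM => //; apply: (invariant_conj primePR).
- by rewrite mulrA rpredM.
Qed.

(** Take [x] in [I] outside [J] and a nonzero [y] in [J]. One of the mutually inverse quotients
    [y * x'] and [x * y'] is in [R]; the second would put [x] in [J], so the first is, and it puts
    [y] in [I]. *)
Lemma division_chain : frac_chain R.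
Proof.
move=> I J; have [[[[_ PR] _ _] _] _ _ _ _] := primePR.
have [I0 _ Il _] := frac_bimodule I; have [J0 _ Jl _] := frac_bimodule J.
have [|nIJ] := pselect (I `<=` J); [by left | right=> y Jy].
have [x Ix nJx] : exists2 x, frac_set I x & ~ frac_set J x.
  by apply: contrapT => no; apply: nIJ => x Ix; apply: contrapT => nJx; apply: no; exists x.
have [->//|y0] := pselect (y = 0).
have [|x' [xx' x'x]] := @divA x; first by move=> x0; apply: nJx; rewrite x0.
have [y' [yy' y'y]] := divA y0.
have e1 : (y * x') * (x * y') = 1 by rewrite mulrA -[_ * x]mulrA x'x mulr1.
have e2 : (x * y') * (y * x') = 1 by rewrite mulrA -[_ * y]mulrA y'y mulr1.
case: (unit_in_ring_or_inv_in_prime primePR e1 e2) => [h|/PR h].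
  by rewrite -[y]mulr1 -x'x mulrA; apply: Il.
by case: nJx; rewrite -[x]mulr1 -y'y mulrA; apply: Jl.
Qed.

End DivisionRing.

Theorem theorem3p1 (A : nzRingType) (R : subringClosed A) (P : set A)
    (simpleA : simple_artinian A) (primePR : invariant_prime R P)
    (goldieR : goldie (subringOf R)) :
  exists (d : Order.disp_t) (Gamma : orderType d)
    (add : Gamma -> Gamma -> Gamma) (zero : Gamma) (v : fracIdeal R -> Gamma),
    [/\ ordered_semigroup add zero,
        arithmetical_pseudo_valuation goldieR add zero v,
        P = value_set v (fun g => (zero < g)%O) &
        [set` R] = value_set v (fun g => (zero <= g)%O)].
Proof.
have [[[[Pb PR] PneR _] _] _ _ _ _] := primePR.
have [P0 _ _ _] := Pb.
case: (division_or_idempotent simpleA) => [divA|[e [ee e0 e1]]].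
  apply: (frac_valuation (division_chain primePR divA)) => //.
    exact: division_frac_principal primePR divA.
  exact: division_principal_full primePR divA.
have fullR : forall a, a \in R.
  apply: (idempotent_full (e := e)) => //; exact: square_zero_in_ring primePR.
(* As [R] is [A], every fractional ideal equals [R] and the chain is a single point; any [a] outside
   [P] is nonzero, so it generates [R]. *)
apply: frac_valuation => //.
- by move=> I J; left; rewrite !full_frac.
- by move=> a a0; rewrite full_principal //; apply: fractional_ring.
- by move=> a _ nPa; apply: full_principal => // a0; apply: nPa; rewrite a0.
Qed.
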